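(* Let $n\ge 3$ and let $R$ be a ring with stable rank $\mathrm{sr}(R)=1$. Let $\sigma\in \mathrm{GL}_n(R)$, let $i,j,k,l\in\{1,\dots,n\}$ with $i\neq j$ and $k\neq l$, and let $a,b,c\in R$. Then (i) $t_{kl}(a\sigma_{ij}b)$ is a product of $8$ $\mathrm{E}_n(R)$-conjugates of $\sigma$ and $\sigma^{-1}$, and (ii) $t_{kl}(a(c\sigma_{ii}-\sigma_{jj}c)b)$ is a product of $24$ $\mathrm{E}_n(R)$-conjugates of $\sigma$ and $\sigma^{-1}$.
   Context: Rings are associative with $1\neq 0$, not necessarily commutative. A row $u=(u_1,\dots,u_m)$ over $R$ is unimodular if there is a column $v$ of length $m$ over $R$ with $uv=1$. The stable rank $\mathrm{sr}(R)$ is the least positive integer $m$ such that for any $p\ge m$ and any unimodular row $(u_1,\dots,u_{p+1})$ over $R$ there are $x_1,\dots,x_p\in R$ such that $(u_1+u_{p+1}x_1,\dots,u_p+u_{p+1}x_p)$ is unimodular ($\mathrm{sr}(R)=\infty$ if no such $m$ exists). $\mathrm{GL}_n(R)$ is the group of invertible $n\times n$ matrices over $R$; $\sigma_{ij}$ is the $(i,j)$ entry of $\sigma$. For $i\ne j$ and $x\in R$, $t_{ij}(x)=e+xe^{ij}$, where $e$ is the identity matrix and $e^{ij}$ is the matrix with $1$ at position $(i,j)$ and $0$ elsewhere. $\mathrm{E}_n(R)$ is the subgroup of $\mathrm{GL}_n(R)$ generated by all $t_{ij}(x)$ ($i\neq j$, $x\in R$). For $g,h$ in a group, $g^h=h^{-1}gh$.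 ''A product of $m$ $\mathrm{E}_n(R)$-conjugates of $\sigma$ and $\sigma^{-1}$'' means a product of $m$ factors, each of the form $\sigma^{\xi}$ or $(\sigma^{-1})^{\xi}$ with $\xi\in \mathrm{E}_n(R)$. *)

(* Defs.v *)
From HB Require Import structures.
From mathcomp Require Import all_boot all_algebra.

Set Implicit Arguments.
Unset Strict Implicit.
Unset Printing Implicit Defensive.

Import GRing.Theory.
Local Open Scope ring_scope.

Definition unimodular (R : nzRingType) (m : nat) (u : 'rV[R]_m) : Prop :=
  exists v : 'cV[R]_m, u *m v = 1%:M.

(* The row (u_1, ..., u_p, u_{p+1}) is split as row_mx u a%:M with a = u_{p+1};
   *: is left multiplication, so the i-th entry of u + a *: x is
   u_i + u_{p+1} * x_i. *)
Definition stable_range (R : nzRingType) (m : nat) : Prop :=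
  forall p : nat, (m <= p)%N ->
  forall (u : 'rV[R]_p) (a : R), unimodular (row_mx u (a%:M : 'M[R]_1)) ->
  exists x : 'rV[R]_p, unimodular (u + a *: x).

(* The stable rank of R is m < oo; it is infinite when this holds for no m. *)
Definition has_stable_rank (R : nzRingType) (m : nat) : Prop :=
  [/\ (0 < m)%N, stable_range R m &
      forall m' : nat, (0 < m')%N -> stable_range R m' -> (m <= m')%N].

(* MathComp's unitmx relies on the determinant, hence on commutativity; over
   an arbitrary ring an invertible matrix is packaged with its (unique)
   two-sided inverse. *)
Record GL (R : nzRingType) (n : nat) := MkGL {
  GLmx : 'M[R]_n;
  GLinvmx : 'M[R]_n;
  GLP : (GLmx *m GLinvmx == 1%:M) && (GLinvmx *m GLmx == 1%:M)
}.

Coercion GLmx : GL >-> matrix.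

Section GLGroup.
Variables (R : nzRingType) (n : nat).
Implicit Types s t : GL R n.

Lemma GLmulmxV s : GLmx s *m GLinvmx s = 1%:M.
Proof. by case/andP: (GLP s) => /eqP. Qed.

Lemma GLmulVmx s : GLinvmx s *m GLmx s = 1%:M.
Proof. by case/andP: (GLP s) => _ /eqP. Qed.

Lemma GLmx_inj : injective (@GLmx R n).
Proof.
move=> s t eq_st.
have eqV : GLinvmx s = GLinvmx t.
  by rewrite -[LHS]mulmx1 -(GLmulmxV t) mulmxA -eq_st GLmulVmx mul1mx.
case: s t eq_st eqV => [A B ABP] [C D CDP] /= eqA eqB; subst C D.
by rewrite (bool_irrelevance ABP CDP).
Qed.

Definition GL_to_sig s : {p : 'M[R]_n * 'M[R]_n |
    (p.1 *m p.2 == 1%:M) && (p.2 *m p.1 == 1%:M)} :=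
  exist _ (GLmx s, GLinvmx s) (GLP s).
Definition GL_of_sig (p : {p : 'M[R]_n * 'M[R]_n |
    (p.1 *m p.2 == 1%:M) && (p.2 *m p.1 == 1%:M)}) : GL R n :=
  MkGL (svalP p).
Fact GL_to_sigK : cancel GL_to_sig GL_of_sig.
Proof. by move=> s; apply: GLmx_inj. Qed.

HB.instance Definition _ := Choice.copy (GL R n) (can_type GL_to_sigK).

Fact GL1_subproof :
  ((1%:M : 'M[R]_n) *m 1%:M == 1%:M) && ((1%:M : 'M[R]_n) *m 1%:M == 1%:M).
Proof. by rewrite mulmx1 eqxx. Qed.

Fact GLM_subproof s t :
  ((GLmx s *m GLmx t) *m (GLinvmx t *m GLinvmx s) == 1%:M) &&
  ((GLinvmx t *m GLinvmx s) *m (GLmx s *m GLmx t) == 1%:M).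
Proof.
rewrite -mulmxA (mulmxA (GLmx t)) GLmulmxV mul1mx GLmulmxV eqxx /=.
by rewrite -mulmxA (mulmxA (GLinvmx s)) GLmulVmx mul1mx GLmulVmx eqxx.
Qed.

Fact GLV_subproof s :
  (GLinvmx s *m GLmx s == 1%:M) && (GLmx s *m GLinvmx s == 1%:M).
Proof. by rewrite GLmulmxV GLmulVmx !eqxx. Qed.

Definition GL_one : GL R n := MkGL GL1_subproof.
Definition GL_mul s t : GL R n := MkGL (GLM_subproof s t).
Definition GL_inv s : GL R n := MkGL (GLV_subproof s).

Fact GL_mulA : associative GL_mul.
Proof. by move=> s t u; apply: GLmx_inj; rewrite /= mulmxA. Qed.
Fact GL_mul1 : left_id GL_one GL_mul.
Proof. by move=> s; apply: GLmx_inj; rewrite /= mul1mx. Qed.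
Fact GL_mulr1 : right_id GL_one GL_mul.
Proof. by move=> s; apply: GLmx_inj; rewrite /= mulmx1. Qed.
Fact GL_mulV : left_inverse GL_one GL_inv GL_mul.
Proof. by move=> s; apply: GLmx_inj; rewrite /= GLmulVmx. Qed.
Fact GL_mulrV : right_inverse GL_one GL_inv GL_mul.
Proof. by move=> s; apply: GLmx_inj; rewrite /= GLmulmxV. Qed.

HB.instance Definition _ :=
  isGroup.Build (GL R n) GL_mulA GL_mul1 GL_mulr1 GL_mulV GL_mulrV.

Definition tmx (i j : 'I_n) (x : R) : 'M[R]_n := 1%:M + x *: delta_mx i j.

Lemma tmxD (i j : 'I_n) (x y : R) :
  i != j -> tmx i j x *m tmx i j y = tmx i j (x + y).
Proof.
move=> neq_ij; rewrite /tmx mulmxDr mulmx1 mulmxDl mul1mx -addrA; congr (_ + _).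
suff -> : (x *: delta_mx i j) *m (y *: delta_mx i j) = 0 :> 'M[R]_n.
  by rewrite addr0 scalerDl.
apply/matrixP=> k l; rewrite !mxE big1 // => h _; rewrite !mxE.
case: (eqVneq h j) => [->|_]; last by rewrite andbF mulr0 mul0r.
by rewrite (eq_sym j i) (negPf neq_ij) /= !mulr0.
Qed.

Fact tGL_subproof (i j : 'I_n) (x : R) : i != j ->
  (tmx i j x *m tmx i j (- x) == 1%:M) && (tmx i j (- x) *m tmx i j x == 1%:M).
Proof.
by move=> neq_ij; rewrite !tmxD // subrr addNr /tmx scale0r addr0 eqxx.
Qed.

Definition tGL (i j : 'I_n) (neq_ij : i != j) (x : R) : GL R n :=
  MkGL (tGL_subproof x neq_ij).

End GLGroup.

Inductive generated (G : groupType) (S : G -> Prop) : G -> Prop :=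
| generated_gen g : S g -> generated S g
| generated_one : generated S 1%g
| generated_mul g h : generated S g -> generated S h -> generated S (g * h)%g
| generated_inv g : generated S g -> generated S (g^-1)%g.

Definition elementary_group (R : nzRingType) (n : nat) : GL R n -> Prop :=
  generated (fun g : GL R n =>
    exists (i j : 'I_n) (neq_ij : i != j) (x : R), g = tGL neq_ij x).

(* The library's conjugation is g ^ h = h^-1 * (g * h). *)
Definition product_of_E_conjugates (R : nzRingType) (n m : nat)
    (sigma g : GL R n) : Prop :=
  exists f : 'I_m -> GL R n,
    (forall r : 'I_m, exists2 xi : GL R n, elementary_group xi &
       f r = (sigma ^ xi)%g \/ f r = (sigma^-1 ^ xi)%g) /\
    g = (\prod_(r < m) f r)%g.

(* Main.v *)
Require Import Defs.
From HB Require Import structures.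
From mathcomp Require Import all_boot all_algebra.

Set Implicit Arguments.
Unset Strict Implicit.
Unset Printing Implicit Defensive.

Import GRing.Theory.
Local Open Scope ring_scope.

(** The construction reads a decomposition of unipotents backwards.  Write
    [e_p] for the standard columns and [f_p] for the standard rows, and call
    [1 + x f_j] with [x_j = 0] a column shear; it is a product of elementary
    transvections [t_pj(x_p)].

    Suppose that a column [x] with a zero coordinate [x_j] is annihilated by
    row [i] of [sigma], and put [tau = 1 + x f_j].  The conjugate
    [xi = sigma tau^-1 sigma^-1 = 1 - (sigma x) (f_j sigma^-1)] then has trivial
    [i]-th row, while [xi tau = sigma (tau^-1 sigma^-1 tau)] is a product of two
    conjugates of [sigma] and [sigma^-1].  Two commutators extract [x_i] from
    it, each doubling the number of factors:
    - up to conjugation by [tau], the commutator of [xi tau] with [t_ki(a)] is a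
      column shear in direction [i] (coming from [xi]) times [t_kj(- a x_i)]
      (coming from [tau]);
    - the commutator of that product with [t_ji(-b)] ignores the shear in
      direction [i], which commutes with [t_ji(-b)], and equals
      [t_ki(a x_i b)].
    This gives eight conjugates ([annihilated_row_transvection]).

    It remains to find [x] with [x_i] essentially [sigma_ij]: if
    [sigma_ii u = 1], then [x = e_j - u sigma_ij e_i] works, since [n >= 3]
    leaves an index [m] with [x_m = 0] to take the place of [j] above, and the
    factor [- u] is undone by replacing [a] with [- a sigma_ii].  Stable rank one
    supplies the right inverse: row [i] of [sigma] is unimodular, so conjugating [sigma] by a
    suitable column shear in direction [i] makes its [(i, i)] entry right
    invertible, and leaves the rest of row [i] unchanged
    ([entry_transvection]).  The indices of the resulting
    transvection are moved at will by elementary conjugation ([tGL_move]).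

    For the second claim, conjugating [sigma] by [t_ji(-c)] turns the [(j, i)]
    entry into
    [sigma_ji + c sigma_ii - sigma_jj c - c sigma_ij c] ([conj_entry]); the two
    superfluous terms are removed by two more applications of the first claim,
    to [sigma_ji] and to [sigma_ij], for [3 * 8 = 24] conjugates altogether. *)

(** * Products of elementary conjugates *)

Section Generated.
Variables (R : nzRingType) (n : nat).
Implicit Types g h s xi : GL R n.

Lemma tGL_elementary (i j : 'I_n) (neq_ij : i != j) (x : R) :
  elementary_group (tGL neq_ij x).
Proof. by apply: generated_gen; exists i, j, neq_ij, x. Qed.

Lemma product_of_E_conjugates_self s : product_of_E_conjugates 1 s s.
Proof.
exists (fun=> s); split; last by rewrite big_ord1.
by move=> _; exists 1%g; [exact: generated_one | left; rewrite conjg1].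
Qed.

Lemma product_of_E_conjugatesM m1 m2 s g h :
  product_of_E_conjugates m1 s g -> product_of_E_conjugates m2 s h ->
  product_of_E_conjugates (m1 + m2) s (g * h)%g.
Proof.
move=> [f1 [Ef1 ->]] [f2 [Ef2 ->]].
exists (fun r => match split r with inl r1 => f1 r1 | inr r2 => f2 r2 end).
split=> [r|]; first by case: (split r).
rewrite big_split_ord; congr (_ * _)%g; apply: eq_bigr => r _.
  by rewrite -[lshift _ r]/(unsplit (inl r)) unsplitK.
by rewrite -[rshift _ r]/(unsplit (inr r)) unsplitK.
Qed.

Lemma product_of_E_conjugates_trans m s xi g : elementary_group xi ->
  product_of_E_conjugates m (s ^ xi)%g g -> product_of_E_conjugates m s g.
Proof.
move=> Exi [f [Ef ->]]; exists f; split=> // r; have [xi' Exi' def_f] := Ef r.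
exists (xi * xi')%g; first exact: generated_mul.
by rewrite !conjgM conjVg.
Qed.

Lemma product_of_E_conjugatesJ m s xi g : elementary_group xi ->
  product_of_E_conjugates m s g -> product_of_E_conjugates m s (g ^ xi)%g.
Proof.
move=> Exi [f [Ef ->]]; exists (fun r => (f r ^ xi)%g).
split=> [r|]; last by rewrite conjg_prod.
have [xi' Exi' def_f] := Ef r.
exists (xi' * xi)%g; first exact: generated_mul.
by rewrite !conjgM; case: def_f => ->; [left | right].
Qed.

Lemma product_of_E_conjugatesV m s g :
  product_of_E_conjugates m s g -> product_of_E_conjugates m s g^-1%g.
Proof.
move=> [f [Ef ->]]; exists (fun r => (f (rev_ord r))^-1%g); split=> [r|].
  have [xi Exi def_f] := Ef (rev_ord r); exists xi => //.
  by case: def_f => ->; rewrite -?conjVg ?invgK; [right | left].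
elim: m f {Ef} => [|m IHm] f; first by rewrite !big_ord0 invg1.
rewrite big_ord_recl invgM IHm big_ord_recr /=; congr (_ * _)%g.
  apply: eq_bigr => r _; congr (_^-1)%g; congr f.
  by apply: val_inj; rewrite /= /bump /= subSn // ltnS ltnW.
by congr (_^-1)%g; congr f; apply: val_inj; rewrite /= subnn.
Qed.

Lemma product_of_E_conjugatesR m s xi g : elementary_group xi ->
  product_of_E_conjugates m s g ->
  product_of_E_conjugates (m + m) s [~ g, xi]%g.
Proof.
move=> Exi Pg; apply: product_of_E_conjugatesM.
  exact: product_of_E_conjugatesV.
exact: product_of_E_conjugatesJ.
Qed.

End Generated.

(** * Column shears *)

Section Shears.
Variables (R : nzRingType) (n : nat).
Implicit Types (g h s t : GL R n) (x y : 'cV[R]_n) (i j k l p q r : 'I_n).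

Local Notation "''col_' i" := (delta_mx i 0 : 'cV[R]_n)
  (at level 8, i at level 2, format "''col_' i").
Local Notation "''row_' i" := (delta_mx 0 i : 'rV[R]_n)
  (at level 8, i at level 2, format "''row_' i").

Lemma row_mul_scale i x : ('row_i *m x) 0 0 = x i 0.
Proof. by rewrite -rowE mxE. Qed.

Lemma row_mul_eq0 i x : ('row_i *m x = 0) <-> (x i 0 = 0).
Proof.
split=> [xi0|xi0]; first by rewrite -row_mul_scale xi0 mxE.
by apply/matrixP=> a b; rewrite !ord1 row_mul_scale xi0 mxE.
Qed.

Lemma GLmxM g h : GLmx (g * h)%g = GLmx g *m GLmx h. Proof. by []. Qed.
Lemma GLmxV g : GLmx g^-1%g = GLinvmx g. Proof. by []. Qed.

Definition fixes_row i g := 'row_i *m GLmx g = 'row_i.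

Lemma fixes_rowV i g : fixes_row i g -> fixes_row i g^-1%g.
Proof.
by rewrite /fixes_row GLmxV => {1}<-; rewrite -mulmxA GLmulmxV mulmx1.
Qed.

(** A relation between [x] and [g], so that products, inverses and conjugates
    of shears are again shears without carrying proofs of [x_j = 0] in terms;
    [x] determines [g] by [colshear_inj]. *)
Definition colshear j x g := 'row_j *m x = 0 /\ GLmx g = 1%:M + x *m 'row_j.

Lemma colshear_fixes_row i j x g :
  'row_i *m x = 0 -> colshear j x g -> fixes_row i g.
Proof.
by move=> xi0 [_ def_g]; rewrite /fixes_row def_g mulmxDr mulmx1 mulmxA xi0
  mul0mx addr0.
Qed.

Lemma colshear_inj j x g h : colshear j x g -> colshear j x h -> g = h.
Proof. by move=> [_ def_g] [_ def_h]; apply: GLmx_inj; rewrite def_g. Qed.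

Lemma colshear1 j : colshear j 0 1%g.
Proof. by split; rewrite ?mulmx0 // mul0mx addr0. Qed.

Lemma colshearM j x y g h :
  colshear j x g -> colshear j y h -> colshear j (x + y) (g * h)%g.
Proof.
move=> [xj0 def_g] [yj0 def_h]; split; first by rewrite mulmxDr xj0 yj0 addr0.
rewrite GLmxM def_g def_h mulmxDr mulmx1 mulmxDl mul1mx mulmxDl.
by rewrite -(mulmxA x) (mulmxA 'row_j) yj0 mul0mx mulmx0 addr0 addrA.
Qed.

Lemma colshearV j x g : colshear j x g -> colshear j (- x) g^-1%g.
Proof.
move=> [xj0 def_g]; split; first by rewrite mulmxN xj0 oppr0.
have gV : GLmx g *m (1%:M + - x *m 'row_j) = 1%:M.
  rewrite def_g mulmxDr mulmx1 mulmxDl mul1mx !mulNmx -(mulmxA x).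
  by rewrite mulmxN (mulmxA 'row_j) xj0 mul0mx oppr0 mulmx0 addr0 addrK.
by rewrite GLmxV -[LHS]mulmx1 -[X in _ *m X]gV mulmxA GLmulVmx mul1mx.
Qed.

(** Since [h^-1 (1 + x f_j) h = 1 + (h^-1 x) (f_j h)], conjugating by an [h]
    that fixes [f_j] only acts on [x]; all the commutators below are computed
    with this rule. *)
Lemma colshearJ j x g h : fixes_row j h ->
  colshear j x g -> colshear j (GLinvmx h *m x) (g ^ h)%g.
Proof.
move=> hj [xj0 def_g]; split.
  by rewrite mulmxA -GLmxV (fixes_rowV hj).
rewrite !GLmxM GLmxV def_g mulmxDl mul1mx mulmxDr GLmulVmx.
by rewrite -(mulmxA x) hj mulmxA.
Qed.

Lemma tGL_colshear i j (neq_ij : i != j) (c : R) :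
  colshear j (c *: 'col_i) (tGL neq_ij c).
Proof.
split; last by rewrite /= /tmx -scalemxAl mul_delta_mx.
by apply/row_mul_eq0; rewrite !mxE eq_sym (negPf neq_ij) mulr0.
Qed.

Lemma scaled_colM k (a c : R) :
  (a *: 'col_k) *m (c%:M : 'M_1) = (a * c) *: 'col_k.
Proof.
apply/colP=> p; rewrite !mxE big_ord1 !mxE eqxx mulr1n.
by case: (p == k); rewrite ?mulr1 ?mulr0 ?mul0r.
Qed.

Lemma mx_mul_scaled_col m (A : 'M[R]_(m, n)) k (c : R) (p : 'I_m) :
  (A *m (c *: 'col_k)) p 0 = A p k * c.
Proof.
rewrite mxE (bigD1 k) //= big1 ?addr0 => [|q /negPf neq_qk]; rewrite !mxE.
  by rewrite eqxx mulr1.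
by rewrite neq_qk !mulr0.
Qed.

Lemma tmx_mul_col i j k (a c : R) :
  tmx i j a *m (c *: 'col_k) = c *: 'col_k + ((j == k)%:R * (a * c)) *: 'col_i.
Proof.
rewrite /tmx mulmxDl mul1mx; congr (_ + _).
apply/matrixP=> u w; rewrite !mxE (bigD1 j) //= big1 ?addr0 => [|m neq_mj].
  by rewrite !mxE !eqxx ord1 eqxx !andbT; case: eqP; case: eqP;
    rewrite /= ?(mulr0, mul0r, mulr1, mul1r).
by rewrite !mxE (negPf neq_mj) andbF mulr0 mul0r.
Qed.

Lemma row_mul_tmx i j k (a : R) :
  'row_k *m tmx i j a = 'row_k + ((k == i)%:R * a) *: 'row_j.
Proof.
rewrite /tmx mulmxDr mulmx1; congr (_ + _).
apply/matrixP=> u v; rewrite -rowE !mxE ord1 eqxx /=.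
by case: eqP; case: eqP; rewrite /= ?(mulr0, mul0r, mulr1, mul1r).
Qed.

Lemma colshear_elementary j x : 'row_j *m x = 0 ->
  exists2 g, elementary_group g & colshear j x g.
Proof.
move/row_mul_eq0=> xj0; rewrite [x]matrix_sum_delta.
pose P y := exists2 g, elementary_group g & colshear j y g.
apply: (big_ind P) => [|y z [g Eg gP] [h Eh hP]|p _].
- by exists 1%g; [exact: generated_one | exact: colshear1].
- by exists (g * h)%g; [exact: generated_mul | exact: colshearM].
rewrite big_ord1; case: (eqVneq p j) => [->|neq_pj].
  by rewrite xj0 scale0r; exists 1%g; [exact: generated_one | exact: colshear1].
by exists (tGL neq_pj (x p 0)); [exact: tGL_elementary | exact: tGL_colshear].
Qed.

(** * Changing the indices of a transvection *)

(** The conjugator [t_qp(-1) t_pq(1)] sends [e_p] to [e_q], as the product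
    of three transvections representing a signed transposition would, but
    without sign and with one factor fewer. *)
Lemma tGL_move_row p q r (neq_pr : p != r) (neq_qr : q != r) (c : R) :
  exists2 xi, elementary_group xi & tGL neq_qr c = (tGL neq_pr c ^ xi)%g.
Proof.
case: (eqVneq q p) => [eq_qp|neq_qp].
  subst q; exists 1%g; first exact: generated_one.
  by rewrite conjg1 (bool_irrelevance neq_qr neq_pr).
have neq_pq : p != q by rewrite eq_sym.
have fix_r i j (neq_ij : i != j) (a : R) : i != r ->
    fixes_row r (tGL neq_ij a).
  move=> neq_ir; rewrite /fixes_row row_mul_tmx eq_sym (negPf neq_ir).
  by rewrite mul0r scale0r addr0.
exists (tGL neq_qp (- 1) * tGL neq_pq 1)%g.
  by apply: generated_mul; exact: tGL_elementary.
rewrite conjgM; apply: (colshear_inj (tGL_colshear neq_qr c)).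
have := colshearJ (fix_r _ _ neq_pq 1 neq_pr)
  (colshearJ (fix_r _ _ neq_qp (- 1) neq_qr) (tGL_colshear neq_pr c)).
rewrite /= !tmx_mul_col mulmxDr !tmx_mul_col !eqxx (negPf neq_qp) opprK.
by rewrite !mul1r mul0r scale0r addr0 mulN1r scaleNr addrCA subrr addr0.
Qed.

(** Dually, [t_pq(1) t_qp(-1)] sends [f_p] to [f_q] and fixes [e_r]. *)
Lemma tGL_move_col r p q (neq_rp : r != p) (neq_rq : r != q) (c : R) :
  exists2 xi, elementary_group xi & tGL neq_rq c = (tGL neq_rp c ^ xi)%g.
Proof.
case: (eqVneq p q) => [eq_pq|neq_pq].
  subst q; exists 1%g; first exact: generated_one.
  by rewrite conjg1 (bool_irrelevance neq_rq neq_rp).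
have neq_qp : q != p by rewrite eq_sym.
pose xi : GL R n := (tGL neq_pq 1 * tGL neq_qp (- 1))%g.
exists xi; first by apply: generated_mul; exact: tGL_elementary.
have row_xi : 'row_p *m GLmx xi = 'row_q.
  rewrite GLmxM mulmxA /= row_mul_tmx eqxx mul1r scale1r mulmxDl !row_mul_tmx.
  rewrite (negPf neq_pq) eqxx mul0r scale0r addr0 mul1r scaleN1r.
  by rewrite addrC subrK.
have col_xi : GLinvmx xi *m (c *: 'col_r) = c *: 'col_r.
  rewrite /xi /= -mulmxA tmx_mul_col [q == r]eq_sym (negPf neq_rq).
  rewrite mul0r scale0r addr0 tmx_mul_col [p == r]eq_sym (negPf neq_rp).
  by rewrite mul0r scale0r addr0.
apply: GLmx_inj; rewrite !GLmxM GLmxV.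
have [_ ->] := tGL_colshear neq_rp c; have [_ ->] := tGL_colshear neq_rq c.
rewrite mulmxDl mul1mx mulmxDr GLmulVmx -(mulmxA _ 'row_p) row_xi.
by rewrite mulmxA col_xi.
Qed.

Lemma third_index (hn : (3 <= n)%N) i j : exists m, (m != i) && (m != j).
Proof.
have /subsetPn[m _] : ~~ ([set: 'I_n] \subset [set i; j]).
  apply: contraTN hn => /subset_leq_card; rewrite cardsT card_ord => le_n.
  by rewrite -ltnNge ltnS (leq_trans le_n) // cards2; case: (_ == _).
by rewrite !inE negb_or => ?; exists m.
Qed.

Lemma tGL_move (hn : (3 <= n)%N) i j k l (neq_ij : i != j) (neq_kl : k != l)
    (c : R) :
  exists2 xi, elementary_group xi & tGL neq_kl c = (tGL neq_ij c ^ xi)%g.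
Proof.
have conj_trans g h s :
    (exists2 xi, elementary_group xi & h = (g ^ xi)%g) ->
    (exists2 xi, elementary_group xi & s = (h ^ xi)%g) ->
  exists2 xi, elementary_group xi & s = (g ^ xi)%g.
  move=> [xi1 E1 ->] [xi2 E2 ->].
  by exists (xi1 * xi2)%g; [exact: generated_mul | rewrite conjgM].
(* The row index [k] is reached directly unless it is the column index. *)
have moves_ne i' j' (neq' : i' != j') : k != j' ->
  exists2 xi, elementary_group xi & tGL neq_kl c = (tGL neq' c ^ xi)%g.
  move=> neq_kj'; apply: conj_trans (tGL_move_col neq_kj' neq_kl c).
  exact: tGL_move_row.
have [m /andP[neq_mi neq_mk]] := third_index hn i k.
have neq_im : i != m by rewrite eq_sym.
apply: conj_trans (tGL_move_col neq_ij neq_im c) _.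
by apply: moves_ne; rewrite eq_sym.
Qed.

(** * Extracting the entries of an invertible matrix *)

Lemma conj_entry s i j (neq_ji : j != i) (c : R) :
  (s ^ tGL neq_ji (- c))%g j i =
  s j i + c * s i i - s j j * c - c * s i j * c.
Proof.
pose s' := (s ^ tGL neq_ji (- c))%g; rewrite -/s'.
have -> : s' j i = ('row_j *m GLmx s' *m (1 *: 'col_i)) 0 0.
  by rewrite mx_mul_scaled_col mulr1 -rowE [in RHS]mxE.
rewrite !GLmxM GLmxV /= opprK !mulmxA row_mul_tmx eqxx mul1r.
rewrite -2!mulmxA mulmxA tmx_mul_col eqxx mul1r mulr1.
set w := (_ + _) *m GLmx s.
have wE p : w 0 p = s j p + c * s i p.
  by rewrite /w mulmxDl -scalemxAl -!rowE !mxE.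
rewrite mulmxDr [LHS]mxE !mx_mul_scaled_col !wE.
by rewrite mulr1 mulrN mulrDl opprD addrA.
Qed.

(** The column [x] is the list of coefficients of a right linear relation
    between the entries of row [i] of [s]; the lemma turns any of these
    coefficients into a transvection, provided that some coefficient [x_j] is
    zero. *)
Lemma annihilated_row_transvection i j k s tau x (a b : R)
    (neq_ki : k != i) (neq_kj : k != j) (neq_ji : j != i) :
    elementary_group tau -> colshear j x tau ->
    'row_i *m (GLmx s *m x) = 0 ->
  product_of_E_conjugates 8 s (tGL neq_ki (a * x i 0 * b)).
Proof.
move=> Etau tauP sxi0.
(* [xi] is [1 - (s x) (f_j s^-1)], and [s x] has zero [i]-th entry. *)
pose xi := ((tau^-1) ^ (s^-1))%g.
have xi_i : fixes_row i xi.
  rewrite /fixes_row /xi !GLmxM !GLmxV /=.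
  have [_] := colshearV tauP; rewrite GLmxV => ->.
  rewrite mulmxDl mul1mx mulmxDr GLmulmxV mulmxDr mulmx1 mulNmx mulNmx mulmxN.
  by rewrite -mulmxA mulmxN !mulmxA -(mulmxA 'row_i) sxi0 !mul0mx oppr0 addr0.
have Pxitau : product_of_E_conjugates 2 s (xi * tau)%g.
  rewrite (_ : (xi * tau)%g = (s * (s^-1) ^ tau)%g).
    apply: (product_of_E_conjugatesM (m1 := 1) (m2 := 1)).
      exact: product_of_E_conjugates_self.
    apply: product_of_E_conjugatesJ => //; apply: product_of_E_conjugatesV.
    exact: product_of_E_conjugates_self.
  by rewrite /xi !conjgE invgK !mulgA.
pose t := tGL neq_ki a.
have tP : colshear i (a *: 'col_k) t := tGL_colshear neq_ki a.
pose g := ([~ xi * tau, t] ^ tau^-1)%g.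
have Pg : product_of_E_conjugates 4 s g.
  apply: product_of_E_conjugatesJ; first exact: generated_inv.
  by apply: (@product_of_E_conjugatesR _ _ 2) => //; exact: tGL_elementary.
(* Conjugating by [tau^-1] separates the contributions of [xi] and [tau]. *)
have def_g : g = (((t^-1) ^ xi * t) * (tau ^ t * tau^-1))%g.
  rewrite /g commgEr conjMg -conjgM mulgK -mulgA !conjgE invgK.
  by rewrite !mulgA mulgK.
have [v vP] : exists v, colshear i v ((t^-1) ^ xi * t)%g.
  exists (GLinvmx xi *m - (a *: 'col_k) + a *: 'col_k).
  exact: (colshearM (colshearJ xi_i (colshearV tP)) tP).
pose c := - (a * x i 0).
(* [t^-1 tau t = 1 + (t^-1 x) f_j], and [t^-1 x - x = - a x_i e_k]. *)
have wP : (tau ^ t * tau^-1)%g = tGL neq_kj c.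
  have t_j : fixes_row j t.
    by apply: (colshear_fixes_row _ tP); apply/row_mul_eq0;
      rewrite !mxE eq_sym (negPf neq_kj) mulr0.
  apply: colshear_inj (tGL_colshear neq_kj c).
  have := colshearM (colshearJ t_j tauP) (colshearV tauP).
  congr (colshear j _ _).
  have [_] := colshearV tP; rewrite GLmxV => ->.
  rewrite mulmxDl mul1mx addrC addKr !mulNmx -mulmxA.
  by rewrite (mx11_scalar ('row_i *m x)) row_mul_scale scaled_colM scaleNr.
rewrite wP in def_g.
pose B := tGL neq_ji (- b).
have BP : colshear i (- b *: 'col_j) B := tGL_colshear neq_ji (- b).
have w_i : fixes_row i (tGL neq_kj c).
  apply: (colshear_fixes_row _ (tGL_colshear neq_kj c)); apply/row_mul_eq0.
  by rewrite !mxE eq_sym (negPf neq_ki) mulr0.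
have v_i : fixes_row i ((t^-1) ^ xi * t)%g.
  by case: (vP) => vi0 _; exact: colshear_fixes_row vP.
(* The first factor of [g] fixes [e_j], the second sends it to
   [e_j + c e_k]; so [g^-1] moves [- b e_j] by a multiple of [e_k] only. *)
rewrite (_ : tGL neq_ki _ = [~ g, B]%g).
  by apply: (@product_of_E_conjugatesR _ _ 4) => //; exact: tGL_elementary.
apply: colshear_inj (tGL_colshear _ _) _.
rewrite commgEr def_g conjgM.
have := colshearM (colshearJ w_i (colshearJ v_i (colshearV BP))) BP.
congr (colshear i _ _).
have [_] := colshearV vP; rewrite GLmxV => ->.
rewrite mulmxDl mul1mx -(mulmxA _ 'row_i) mulmxN.
have -> : 'row_i *m (- b *: 'col_j) = 0 by case: BP.
rewrite oppr0 mulmx0 addr0 mulmxN /= tmx_mul_col eqxx mul1r opprD addrAC addNr.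
by rewrite add0r -scaleNr /c !(mulrN, mulNr) !opprK.
Qed.

(** This is the stable range condition for the row [(a, c)], with both
    unimodularity statements written out. *)
Lemma stable_range1_right_inverse (sr1 : stable_range R 1) (a c v : R) :
  a * v + c = 1 -> exists y u : R, (a + c * y) * u = 1.
Proof.
move=> av_c1; have [|x [w xw1]] := sr1 1%N (leqnn 1) a%:M c.
  exists (col_mx v%:M 1%:M).
  by rewrite mul_row_col mulmx1 -scalar_mxM -raddfD /= av_c1.
exists (x 0 0), (w 0 0); have := congr1 (fun A : 'M_1 => A 0 0) xw1.
by rewrite !mxE big_ord1 !mxE !eqxx !mulr1n.
Qed.

(** One application of the stable range condition is enough for a row of any
    length: the terms [s_ip v_p] with [p != i] are lumped into a single ring
    element [c], and the multiplier [y] found for [c] is spread back as the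
    column of coefficients [v_p y]. *)
Lemma entry_transvection (hn : (3 <= n)%N) (sr1 : stable_range R 1)
    s i j k l (neq_ij : i != j) (neq_kl : k != l) (a b : R) :
  product_of_E_conjugates 8 s (tGL neq_kl (a * s i j * b)).
Proof.
have neq_ji : j != i by rewrite eq_sym.
have [m /andP[neq_mi neq_mj]] := third_index hn i j.
have neq_jm : j != m by rewrite eq_sym.
(* Column [i] of the inverse of [s], with its [i]-th entry deleted. *)
pose v : 'cV[R]_n := \col_p ((p != i)%:R * GLinvmx s p i).
have [y [u unit_u]] :
    exists y u : R, (s i i + ('row_i *m GLmx s *m v) 0 0 * y) * u = 1.
  apply: (stable_range1_right_inverse sr1 (v := GLinvmx s i i)).
  have := congr1 (fun A : 'M_n => A i i) (GLmulmxV s).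
  rewrite -rowE !mxE eqxx mulr1n => <-; rewrite [RHS](bigD1 i) //=.
  congr (_ + _).
  rewrite (bigD1 i) //= !mxE eqxx mul0r mulr0 add0r.
  by apply: eq_bigr => p neq_pi; rewrite !mxE neq_pi mul1r.
have [|g Eg gP] := @colshear_elementary i (v *m (y%:M : 'M_1)).
  by apply/row_mul_eq0; rewrite !mxE big_ord1 !mxE eqxx !mul0r.
pose s' := (s ^ g)%g; pose u0 := s i i + ('row_i *m GLmx s *m v) 0 0 * y.
(* Row [i] of [s'] has entries [u0] and [s i j] in columns [i] and [j], and
   [u0 * u = 1]. *)
pose x : 'cV[R]_n := - (u * s i j) *: 'col_i + 1 *: 'col_j.
have xm0 : 'row_m *m x = 0.
  by apply/row_mul_eq0; rewrite !mxE (negPf neq_mi) (negPf neq_mj) !mulr0 addr0.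
have xi : x i 0 = - (u * s i j).
  by rewrite !mxE eqxx (negPf neq_ij) mulr1 mulr0 addr0.
have [tau Etau tauP] := colshear_elementary xm0.
have s'x0 : 'row_i *m (GLmx s' *m x) = 0.
  have [gi0 def_g] := gP.
  have row_s' : 'row_i *m GLmx s' =
      'row_i *m GLmx s + (('row_i *m GLmx s *m v) 0 0 * y) *: 'row_i.
    rewrite /s' !GLmxM mulmxA [_ *m GLmx _^-1%g](fixes_rowV _); last first.
      exact: colshear_fixes_row gP.
    rewrite def_g mulmxDr mulmx1 mulmxDr !mulmxA.
    by rewrite [_ *m v]mx11_scalar -scalar_mxM mul_scalar_mx [_%:M 0 0]mxE.
  rewrite mulmxA row_s' mulmxDl -scalemxAl; apply/matrixP=> p q.
  rewrite !ord1 mxE [X in _ + X]mxE row_mul_scale xi mulmxDr -rowE.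
  rewrite mxE !mx_mul_scaled_col !mxE mulr1 !mulrN addrAC -opprD -mulrDl.
  move: unit_u; rewrite -rowE [in X in X -> _]mxE => unit_u.
  by rewrite mulrA unit_u mul1r addNr.
have [xi0 Exi0 ->] := tGL_move hn neq_ji neq_kl (a * s i j * b).
apply: product_of_E_conjugatesJ => //.
apply: (product_of_E_conjugates_trans Eg).
(* The multiplier [- (a * u0)] cancels the factor [- u] of [x i 0]. *)
have := annihilated_row_transvection (- (a * u0)) b neq_ji neq_jm neq_mi
  Etau tauP s'x0.
by rewrite xi mulrNN !mulrA -(mulrA a u0) unit_u mulr1.
Qed.

End Shears.

Theorem theorem18 (n : nat) (hn : (3 <= n)%N) (R : nzRingType)
    (hsr : has_stable_rank R 1) (sigma : GL R n)
    (i j k l : 'I_n) (neq_ij : i != j) (neq_kl : k != l) (a b c : R) :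
  product_of_E_conjugates 8 sigma (tGL neq_kl (a * sigma i j * b)) /\
  product_of_E_conjugates 24 sigma
    (tGL neq_kl (a * (c * sigma i i - sigma j j * c) * b)).
Proof.
have [_ sr1 _] := hsr; split; first exact: entry_transvection.
have neq_ji : j != i by rewrite eq_sym.
pose sigma' := (sigma ^ tGL neq_ji (- c))%g.
have sigma'_ji : sigma' j i =
    sigma j i + c * sigma i i - sigma j j * c - c * sigma i j * c.
  exact: conj_entry.
have -> : tGL neq_kl (a * (c * sigma i i - sigma j j * c) * b) =
    (tGL neq_kl (a * sigma' j i * b) *
     (tGL neq_kl (- a * sigma j i * b) *
      tGL neq_kl (a * c * sigma i j * (c * b))))%g.
  apply: GLmx_inj; rewrite !GLmxM /= !tmxD // sigma'_ji; congr tmx.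
  rewrite !(mulrBl, mulrBr, mulrDl, mulrDr) !mulNr !mulrA addrA addrAC subrK.
  by rewrite addrAC [_ + a * c * _ * b]addrC addrK.
apply: (@product_of_E_conjugatesM _ _ 8 16).
  apply: (@product_of_E_conjugates_trans _ _ _ _ (tGL neq_ji (- c))).
    exact: tGL_elementary.
  exact: entry_transvection.
by apply: (@product_of_E_conjugatesM _ _ 8 8); exact: entry_transvection.
Qed.
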